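(* For every integer $d \ge 2$ there is a $d$-dimensional semialgebraic predicate $\Phi$ of arity $k = d+3$ and a constant $c>0$ such that $R_\Phi(n) \ge \operatorname{twr}_{k-1}(c\,n)$ for all sufficiently large $n$ (i.e., $R_\Phi(n)\ge \operatorname{twr}_{k-1}(\Omega(n))$).
   Context: For points $x_1,\dots,x_k\in\mathbb{R}^d$ write $x_{i,j}$ for the $j$th coordinate of $x_i$. A $k$-ary $d$-dimensional semialgebraic predicate $\Phi(x_1,\dots,x_k)$ is a Boolean combination of polynomial equations and inequalities in the $kd$ variables $x_{i,j}$: there are a Boolean formula $\phi(X_1,\dots,X_t)$ and real polynomials $f_1,\dots,f_t$ in the $x_{i,j}$ such that $\Phi(x_1,\dots,x_k)=\phi(A_1,\dots,A_t)$, where $A_\ell$ is true iff $f_\ell(x_{1,1},\dots,x_{k,d})\ge 0$. A sequence $(p_1,\dots,p_n)$ of points of $\mathbb{R}^d$ is $\Phi$-homogeneous if either $\Phi(p_{i_1},\dots,p_{i_k})$ holds for all $1\le i_1<\dots<i_k\le n$, or it holds for no such choice. $R_\Phi(n)$ is the smallest $N$ such that every sequence of $N$ points in $\mathbb{R}^d$ contains a $\Phi$-homogeneous subsequence of length $n$. The tower function is $\operatorname{twr}_1(x)=x$, $\operatorname{twr}_{i+1}(x)=2^{\operatorname{twr}_i(x)}$. *)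

(* Defs.v *)
From mathcomp Require Import all_boot all_order all_algebra.
From mathcomp Require Import boolp reals exp.
From mathcomp Require mpoly.

Set Implicit Arguments.
Unset Strict Implicit.
Unset Printing Implicit Defensive.

Import Order.TTheory GRing.Theory Num.Theory.
Local Open Scope ring_scope.

Inductive bformula (t : nat) : Type :=
| BVar of 'I_t
| BTrue
| BFalse
| BNot of bformula t
| BAnd of bformula t & bformula t
| BOr of bformula t & bformula t.

Fixpoint beval (t : nat) (A : 'I_t -> bool) (phi : bformula t) : bool :=
  match phi with
  | BVar l => A l
  | BTrue => true
  | BFalse => false
  | BNot p => ~~ beval A p
  | BAnd p q => beval A p && beval A q
  | BOr p q => beval A p || beval A q
  end.

Record semialg_pred (R : realType) (k d : nat) : Type := SemialgPred {
  sa_natoms : nat;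
  sa_formula : bformula sa_natoms;
  sa_poly : 'I_sa_natoms -> mpoly.mpoly (k * d) R }.
Arguments sa_natoms {R k d} _.
Arguments sa_formula {R k d} _.
Arguments sa_poly {R k d} _ _.

(* The variable x_{i,j} is the one of index [mxvec_index i j]. *)
Definition coords (R : realType) (k d : nat) (x : 'I_k -> 'rV[R]_d) :
    'I_(k * d) -> R :=
  mxvec (\matrix_(i < k) x i) ord0.

Definition holds (R : realType) (k d : nat) (Phi : semialg_pred R k d)
    (x : 'I_k -> 'rV[R]_d) : bool :=
  beval (fun l => 0 <= mpoly.meval (coords x) (sa_poly Phi l))
        (sa_formula Phi).

Definition homogeneous (R : realType) (k d : nat) (Phi : semialg_pred R k d)
    (n : nat) (p : n.-tuple 'rV[R]_d) : Prop :=
  (forall i : 'I_k -> 'I_n, {homo i : a b / (a < b)%N} ->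
     holds Phi (fun a => tnth p (i a))) \/
  (forall i : 'I_k -> 'I_n, {homo i : a b / (a < b)%N} ->
     ~~ holds Phi (fun a => tnth p (i a))).

Definition ramsey_prop (R : realType) (k d : nat) (Phi : semialg_pred R k d)
    (n N : nat) : Prop :=
  forall p : N.-tuple 'rV[R]_d,
    exists q : n.-tuple 'rV[R]_d, subseq q p /\ homogeneous Phi q.

(* Ramsey's theorem, needed for the minimum defining [ramsey_number] to exist. *)
Lemma ramsey_seq (k a b : nat) : exists N : nat,
  forall (T : eqType) (c : seq T -> bool) (s : seq T), (N <= size s)%N ->
  (exists t, [/\ subseq t s, size t = a &
     forall u, subseq u t -> size u = k -> c u]) \/
  (exists t, [/\ subseq t s, size t = b &
     forall u, subseq u t -> size u = k -> ~~ c u]).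
Proof.
elim: k a b => [|k IHk] a b.
  exists (maxn a b) => T c s; rewrite geq_max => /andP[sa sb].
  case c0: (c [::]).
    left; exists (take a s); split; first exact: take_subseq.
      exact: size_takel.
    by move=> u _ /size0nil ->.
  right; exists (take b s); split; first exact: take_subseq.
    exact: size_takel.
  by move=> u _ /size0nil ->; rewrite c0.
have empty (T : eqType) (s : seq T) (P : seq T -> Prop) :
    exists t, [/\ subseq t s, size t = 0 &
      forall u, subseq u t -> size u = k.+1 -> P u].
  exists [::]; split => //; first exact: sub0seq.
  by move=> u; rewrite subseq0 => /eqP ->.
elim: a b => [|a IHa] b.
  by exists 0 => T c s _; left; apply: empty.
elim: b => [|b [B HB]].
  by exists 0 => T c s _; right; apply: (empty _ _ (fun u => ~~ c u)).
have [A HA] := IHa b.+1.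
have [M HM] := IHk A B.
exists M.+1 => T c [//|x s] sM.
have ext (t : seq T) (m : nat) (P : seq T -> Prop) : size t = m ->
    (forall u, subseq u t -> size u = k -> P (x :: u)) ->
    (forall u, subseq u t -> size u = k.+1 -> P u) ->
    size (x :: t) = m.+1 /\
    (forall u, subseq u (x :: t) -> size u = k.+1 -> P u).
  move=> st h1 h2; split; first by rewrite /= st.
  move=> [//|y u] /=; case: eqP => [-> su [sz]|_ su sz]; first exact: h1.
  exact: h2.
case: (HM T (fun u => c (x :: u)) s sM) => -[t [ts st ht]].
  case: (HA T c t); first by rewrite st.
    move=> [r [rt sr hr]]; left; exists (x :: r).
    have [] // := ext r a (fun u => c u) sr.
      by move=> u ur; apply: ht; apply: subseq_trans rt.
    by split => //=; rewrite eqxx; apply: subseq_trans ts.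
  move=> [r [rt sr hr]]; right; exists r; split => //.
  exact: subseq_trans rt (subseq_trans ts (subseq_cons _ _)).
case: (HB T c t); first by rewrite st.
  move=> [r [rt sr hr]]; left; exists r; split => //.
  exact: subseq_trans rt (subseq_trans ts (subseq_cons _ _)).
move=> [r [rt sr hr]]; right; exists (x :: r).
have [] // := ext r b (fun u => ~~ c u) sr.
  by move=> u ur; apply: ht; apply: subseq_trans rt.
by split => //=; rewrite eqxx; apply: subseq_trans ts.
Qed.

Lemma subseq_tnth_incr (T : eqType) (n k : nat) (q : n.-tuple T)
    (i : 'I_k -> 'I_n) : {homo i : a b / (a < b)%N} ->
  subseq [seq tnth q (i a) | a <- enum 'I_k] q.
Proof.
move=> hi; rewrite -[X in subseq _ X](map_tnth_enum q).
rewrite (map_comp (tnth q) i); apply: map_subseq.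
apply/subseq_uniqP; first exact: enum_uniq.
have tr : transitive (fun a b : 'I_n => (a < b)%N).
  by move=> y x z; apply: ltn_trans.
have srt m : sorted (fun a b : 'I_m => (a < b)%N) (enum 'I_m).
  by have := iota_ltn_sorted 0 m; rewrite -val_enum_ord sorted_map.
apply: (irr_sorted_eq tr).
- by move=> x; apply: ltnn.
- by rewrite sorted_map; apply: sub_sorted (srt k) => a b; apply: hi.
- exact: (sorted_filter tr _ (srt n)).
- by move=> x; rewrite mem_filter mem_enum andbT.
Qed.

Lemma ramsey_prop_ex (R : realType) (k d : nat) (Phi : semialg_pred R k d)
  (n : nat) : exists N : nat, `[< ramsey_prop Phi n N >].
Proof.
have [N HN] := ramsey_seq k n n.
exists N; apply/asboolP => p.
pose c (u : seq 'rV[R]_d) := holds Phi (fun a => nth 0 u a).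
have cE (q : n.-tuple 'rV[R]_d) (i : 'I_k -> 'I_n) :
    holds Phi (fun a => tnth q (i a)) =
    c [seq tnth q (i a) | a <- enum 'I_k].
  congr (holds _ _); apply/funext => a.
  by rewrite (nth_map a) ?size_enum_ord // nth_ord_enum.
case: (HN _ c p); first by rewrite size_tuple.
  move=> [t [tp /eqP st ht]]; exists (Tuple st); split => //; left=> i hi.
  rewrite cE; apply: ht; last by rewrite size_map size_enum_ord.
  exact: (@subseq_tnth_incr _ _ _ (Tuple st) i hi).
move=> [t [tp /eqP st ht]]; exists (Tuple st); split => //; right=> i hi.
rewrite cE; apply: ht; last by rewrite size_map size_enum_ord.
exact: (@subseq_tnth_incr _ _ _ (Tuple st) i hi).
Qed.

Definition ramsey_number (R : realType) (k d : nat)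
    (Phi : semialg_pred R k d) (n : nat) : nat :=
  ex_minn (ramsey_prop_ex Phi n).

(* [twr 1 x = x] and [twr i.+2 x = 2 `^ twr i.+1 x]; [twr 0] is junk. *)
Definition twr (R : realType) (i : nat) (x : R) : R :=
  iter i.-1 (fun y : R => 2 `^ y) x.

(* Main.v *)
(* Erdos-Hajnal stepping up, realized geometrically. Write delta u v for the highest
   bit in which the binary expansions of u and v differ. A colouring of the k-subsets
   of {0,...,N-1} without monochromatic n-set yields one of the (k+1)-subsets of
   {0,...,2^N-1} without monochromatic (2n+k)-set: colour v_0 < ... < v_k according to
   the sequence delta v_i v_{i+1}, which is either monotone (then use the old colour)
   or has a local extremum (then use the kind of the extremum).

   If the old colouring is realized by points p_i of R^d, then the new one is realized
   in R^{d+1} by X(v) = sum_i bit_i(v) M^i (1, p_i) with M large: the direction of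
   X(v) - X(u) is close to (1, p_(delta u v)), so the old predicate can be evaluated on
   ratios of coordinates of differences. Everything is robust under perturbation, which
   lets the step be iterated. In dimension 1 two steps are made at once, with
   X(v) = sum_i bit_i(v) M^(a_i) and a_i = sum_j bit_j(i) 4^j: the differences D_0, D_1,
   D_2 of four points have exponents a_(delta), and D_1^2 < D_0 D_2 compares the two
   gaps between these, that is, their second-level deltas. *)

Require Import Defs.
From mathcomp Require Import all_boot all_order all_algebra.
From mathcomp Require Import boolp reals exp.
From mathcomp Require Import zify ring lra.
From mathcomp Require mpoly.
Import (canonicals) mpoly.

Set Implicit Arguments.
Unset Strict Implicit.
Unset Printing Implicit Defensive.

Import Order.TTheory GRing.Theory Num.Theory.
Local Open Scope nat_scope.

(** * The highest bit in which two numbers differ *)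

Lemma agree_above_ex (u v : nat) : exists i, u %/ 2 ^ i.+1 == v %/ 2 ^ i.+1.
Proof.
exists (u + v).
have lt x : x <= u + v -> x %/ 2 ^ (u + v).+1 = 0.
  move=> le; apply: divn_small; apply: (leq_ltn_trans le).
  exact: ltn_trans (ltnSn _) (ltn_expl _ _).
by rewrite !lt ?leq_addr ?leq_addl.
Qed.

(* The position of the highest bit in which [u] and [v] differ; [0] when [u = v]. *)
Definition delta (u v : nat) : nat := ex_minn (agree_above_ex u v).

Lemma delta_leE (u v i : nat) :
  (delta u v <= i) = (u %/ 2 ^ i.+1 == v %/ 2 ^ i.+1).
Proof.
rewrite /delta; case: ex_minnP => m /eqP em minm.
apply/idP/idP => [le|/minm //].
have -> : i.+1 = m.+1 + (i - m) by lia.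
by rewrite expnD !divnMA em.
Qed.

Lemma delta_bits (u v : nat) : u < v ->
  odd (v %/ 2 ^ delta u v) && ~~ odd (u %/ 2 ^ delta u v).
Proof.
move=> uv; set e := delta u v.
have le : u %/ 2 ^ e <= v %/ 2 ^ e by apply: leq_div2r; apply: ltnW.
have ne : u %/ 2 ^ e != v %/ 2 ^ e.
  case E: e => [|m]; first by rewrite expn0 !divn1; lia.
  by rewrite -delta_leE -/e E ltnn.
have : u %/ 2 ^ e.+1 == v %/ 2 ^ e.+1 by rewrite -delta_leE.
rewrite expnSr !divnMA !divn2 => /eqP; lia.
Qed.

(** The bit of [v] is 1 at position [delta u v] and 0 at position [delta v w]. *)
Lemma delta_neq (u v w : nat) : u < v -> v < w -> delta u v != delta v w.
Proof.
move=> /delta_bits/andP[uv _] /delta_bits/andP[_ vw].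
by apply: contraNneq vw => <-.
Qed.

(** Agreement above bit [i] is equality of quotients by a power of 2. Quotients are monotone, so
    those of [u] and [w] are equal iff both equal that of [v]. *)
Lemma delta_trans (u v w : nat) : u < v -> v < w ->
  delta u w = maxn (delta u v) (delta v w).
Proof.
move=> uv vw.
have E i : (delta u w <= i) = (maxn (delta u v) (delta v w) <= i).
  rewrite geq_max !delta_leE.
  have := leq_div2r (2 ^ i.+1) (ltnW uv); have := leq_div2r (2 ^ i.+1) (ltnW vw).
  lia.
by apply/eqP; rewrite eqn_leq -E leqnn E leqnn.
Qed.

Lemma delta_lt (N u v : nat) : 0 < N -> u < 2 ^ N -> v < 2 ^ N -> delta u v < N.
Proof. by case: N => // N _ uN vN; rewrite ltnS delta_leE !divn_small. Qed.

(** * Delta sequences along monotone runs *)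

Definition deltas (s : seq nat) : seq nat :=
  if s is x :: s' then pairmap delta x s' else [::].

Lemma size_deltas (s : seq nat) : size (deltas s) = (size s).-1.
Proof. by case: s => //= x s; rewrite size_pairmap. Qed.

Lemma nth_deltas (s : seq nat) (i : nat) : i.+1 < size s ->
  nth 0 (deltas s) i = delta (nth 0 s i) (nth 0 s i.+1).
Proof. by case: s => //= x s H; rewrite (nth_pairmap 0). Qed.

Section Steps.
Variables (t : nat -> nat) (lo hi : nat).
Hypothesis t_incr : forall i, i < hi -> t i < t i.+1.
Let D i := delta (t i) (t i.+1).

Lemma lt_of_succ a b : a < b -> b <= hi -> t a < t b.
Proof.
elim: b => // b IH; rewrite ltnS leq_eqVlt => /predU1P[-> //|ab] bhi.
  exact: t_incr.
by apply: ltn_trans (t_incr bhi); apply: IH => //; apply: ltnW.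
Qed.

(** By [delta_trans], the delta of two terms is the maximum of [D] over the steps between them, here
    its last value; in a decreasing run it is the first one. *)
Lemma delta_incr_run : (forall i, lo <= i -> i.+1 < hi -> D i < D i.+1) ->
  forall a b, lo <= a -> a <= b -> b < hi -> delta (t a) (t b.+1) = D b.
Proof.
move=> inc a b la; elim: b => [|b IH].
  by rewrite leqn0 => /eqP ->.
rewrite leq_eqVlt => /predU1P[-> //|]; rewrite ltnS => ab bhi.
rewrite (@delta_trans _ (t b.+1)); last 2 first.
- by apply: lt_of_succ; lia.
- by apply: t_incr.
rewrite IH //; last exact: ltnW.
by rewrite -/(D b.+1); apply/maxn_idPr/ltnW/inc => //; lia.
Qed.

Lemma delta_decr_run : (forall i, lo <= i -> i.+1 < hi -> D i.+1 < D i) ->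
  forall a b, lo <= a -> a < b -> b <= hi -> delta (t a) (t b) = D a.
Proof.
move=> dec a b la; elim: b => [//|b IH].
rewrite ltnS leq_eqVlt => /predU1P[<- //|ab] bhi.
rewrite (@delta_trans _ (t b)); last 2 first.
- by apply: lt_of_succ; lia.
- by apply: t_incr.
rewrite IH //; last exact: ltnW.
rewrite -/(D b); apply/maxn_idPl.
have: D b <= D a; last by [].
elim: {IH} b ab bhi => [//|b IH]; rewrite ltnS leq_eqVlt => /predU1P[<-|ab] bhi.
  by apply/ltnW/dec; lia.
by apply: leq_trans (IH ab (ltnW bhi)); apply/ltnW/dec; lia.
Qed.

(** Any selection of values of [D] from an increasing run is again a delta sequence: one takes the
    upper ends of the selected steps, preceded by the lower end of the first. *)
Lemma deltas_incr_run :
  (forall i, lo <= i -> i.+1 < hi -> D i < D i.+1) ->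
  forall a s, lo <= a -> path ltn a s -> all (ltn^~ hi) (a :: s) ->
  deltas (t a :: map (t \o succn) (a :: s)) = map D (a :: s).
Proof.
move=> inc a s la pth al /=; congr cons.
have {pth} : path ltn a s && all (leq lo) s.
  rewrite pth /=; apply/allP => x xs.
  have /allP/(_ _ xs) := order_path_min ltn_trans pth; lia.
elim: s a la al => //= b s IH a la /and3P[ah bh al] /andP[/andP[ab pth] /andP[lb ls]].
rewrite [X in X :: _](delta_incr_run inc) //; last by apply: leq_trans la _.
by congr cons; apply: IH => //; rewrite ?bh ?al ?pth.
Qed.

(** Here the lower ends of the selected steps are taken, followed by the upper end of the last. *)
Lemma deltas_decr_run :
  (forall i, lo <= i -> i.+1 < hi -> D i.+1 < D i) ->
  forall a s, lo <= a -> path ltn a s -> all (ltn^~ hi) (a :: s) ->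
  deltas (rcons (map t (a :: s)) (t (last a s).+1)) = map D (a :: s).
Proof.
move=> dec a s la /=.
elim: s a la => //= b s IH a la /andP[ab pth] /and3P[ah bh al].
rewrite (delta_decr_run dec) //; last exact: ltnW.
by congr cons; apply: IH => //; rewrite ?bh //; apply: leq_trans la (ltnW ab).
Qed.

End Steps.

(** * Colourings without large monochromatic sets and the stepping-up lemma *)

Definition incr_below (N : nat) (t : seq nat) : bool :=
  sorted ltn t && all (ltn^~ N) t.

Definition monochromatic (c : seq nat -> bool) (k : nat) (t : seq nat)
    (b : bool) : Prop :=
  forall u, subseq u t -> size u = k -> c u = b.

Definition ramsey_free (c : seq nat -> bool) (k N n : nat) : Prop :=
  forall t b, incr_below N t -> size t = n -> ~ monochromatic c k t b.

Lemma incr_below_subseq N t u : subseq u t -> incr_below N t -> incr_below N u.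
Proof.
move=> ut /andP[st at_]; apply/andP; split.
  exact: subseq_sorted ltn_trans _ _ ut st.
by apply/allP => x /(mem_subseq ut); apply: (allP at_).
Qed.

Lemma ramsey_free_leq c k N n m : n <= m ->
  ramsey_free c k N n -> ramsey_free c k N m.
Proof.
move=> nm rf t b it st mono.
have tt : subseq (take n t) t by apply: take_subseq.
apply: (rf (take n t) b); first exact: incr_below_subseq it.
  by rewrite size_takel // st.
by move=> u ut; apply: mono; apply: subseq_trans tt.
Qed.

Definition color3 (w : seq nat) : bool :=
  let ds := deltas w in nth 0 ds 0 < nth 0 ds 1.

(** A decreasing delta sequence is reversed since [c] is meant for increasing lists. In the last
    case the colour is true exactly when the second delta is a local maximum. *)
Definition step_color (c : seq nat -> bool) (w : seq nat) : bool :=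
  let ds := deltas w in
  if sorted ltn ds then c ds
  else if sorted gtn ds then c (rev ds)
  else (nth 0 ds 0 < nth 0 ds 1) && (nth 0 ds 2 < nth 0 ds 1).

Lemma incr_below_nth N t i j : incr_below N t -> i < j -> j < size t ->
  nth 0 t i < nth 0 t j /\ nth 0 t j < N.
Proof.
move=> /andP[st /allP at_] ij js; split; last by apply/at_/mem_nth.
by have := sorted_ltn_nth ltn_trans 0 st; apply => //; rewrite inE //; lia.
Qed.

Lemma nth_window (t : seq nat) i j k : j < k -> nth 0 (take k (drop i t)) j = nth 0 t (i + j).
Proof. by move=> jk; rewrite nth_take // nth_drop. Qed.

Lemma window_subseq (t : seq nat) i k : subseq (take k (drop i t)) t.
Proof. exact: subseq_trans (take_subseq _ _) (drop_subseq _ _). Qed.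

Lemma size_window (t : seq nat) i k : i + k <= size t -> size (take k (drop i t)) = k.
Proof. by move=> le; rewrite size_takel // size_drop; lia. Qed.

Lemma map_nth_subseq (t : seq nat) (s : seq nat) :
  sorted ltn s -> all (ltn^~ (size t)) s -> subseq (map (nth 0 t) s) t.
Proof.
move=> ss sa.
have E : map (nth 0 t) (iota 0 (size t)) = t by exact: mkseq_nth.
rewrite -[X in subseq _ X]E; apply: map_subseq; apply/subseq_uniqP; first exact: iota_uniq.
apply: (irr_sorted_eq ltn_trans ltnn) => //.
  by apply: sorted_filter; [exact: ltn_trans | exact: iota_ltn_sorted].
move=> x; rewrite mem_filter mem_iota /=; case xs: (x \in s) => //=.
by rewrite add0n; symmetry; apply: (allP sa).
Qed.

Lemma subseq_map_ex (T U : eqType) (f : T -> U) (s : seq T) (u : seq U) :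
  subseq u (map f s) -> exists2 r, subseq r s & u = map f r.
Proof.
move=> /subseqP[m sm ->]; exists (mask m s); last by rewrite map_mask.
by apply/subseqP; exists m => //; rewrite sm size_map.
Qed.

(** A monochromatic set of [s + 2] points would have [s + 1] strictly monotone deltas, all below
    [s]. *)
Lemma color3_ramsey_free (s : nat) : 0 < s -> ramsey_free color3 3 (2 ^ s) (s + 2).
Proof.
move=> s0 t b it st mono.
pose D i := delta (nth 0 t i) (nth 0 t i.+1).
have Db i : i < s -> (D i < D i.+1) = b.
  move=> is_; rewrite -(mono (take 3 (drop i t))); last 2 first.
  - exact: window_subseq.
  - by apply: size_window; lia.
  have sz : size (take 3 (drop i t)) = 3 by apply: size_window; lia.
  by rewrite /color3 !nth_deltas ?sz // !nth_window // addn0 addn1 addn2.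
have Ds i : i <= s -> D i < s.
  move=> is_; have [|lt1 lt2] := @incr_below_nth _ _ i i.+1 it (ltnSn _); first by lia.
  by apply: delta_lt => //; apply: ltn_trans lt2.
have Dne i : i < s -> D i != D i.+1.
  move=> is_; have [|lt1 _] := @incr_below_nth _ _ i i.+1 it (ltnSn _); first by lia.
  have [|lt2 _] := @incr_below_nth _ _ i.+1 i.+2 it (ltnSn _); first by lia.
  exact: delta_neq.
case: b {mono} Db => Db.
  have H i : i <= s -> i <= D i.
    elim: i => // i IH is_; have := Db i is_; have := IH (ltnW is_); lia.
  have := H s (leqnn s); have := Ds s (leqnn s); lia.
have H i : i <= s -> i + D i < s.
  elim: i => [|i IH] is_; first exact: Ds.
  have := Db i is_; have := Dne i is_; have := IH (ltnW is_); lia.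
by have := H s (leqnn s); lia.
Qed.

(** Either the first [n.-1] values are all true, or one of them is false and [f] remains false from
    there on. *)
Lemma constant_run (f : nat -> bool) (n : nat) :
  (forall i, i.+2 < 2 * n -> ~~ f i -> ~~ f i.+1) ->
  exists lo v, lo <= n /\ forall i, lo <= i -> i.+1 < lo + n -> f i = v.
Proof.
move=> stay; case: (boolP (all f (iota 0 n.-1))) => [/allP al|/allPn[j]].
  exists 0, true; split=> // i _ ilt; apply: al; rewrite mem_iota; lia.
rewrite mem_iota => jn fj; exists n, false; split=> // i ni ilt.
apply/negbTE.
have : j <= i by lia.
elim: i ilt {ni} => [|i IH] ilt; first by rewrite leqn0 => /eqP <-.
rewrite leq_eqVlt => /predU1P[<- //|ji].
by apply: stay; [lia|apply: IH => //; lia].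
Qed.

(** In a monochromatic set only one kind of turn of the delta sequence is possible, which leaves a
    monotone run of [n] deltas. Each [k]-subset of the run is the delta sequence of [k.+1] points,
    so the run would be monochromatic for [c]. *)
Lemma step_color_ramsey_free c k N n : 3 <= k -> 0 < N ->
  ramsey_free c k N n -> ramsey_free (step_color c) k.+1 (2 ^ N) (2 * n + k).
Proof.
move=> k3 N0 rf t b it st mono.
pose T i := nth 0 t i; pose D i := delta (T i) (T i.+1).
have T_incr i : i.+1 < size t -> T i < T i.+1 /\ T i.+1 < 2 ^ N.
  by move=> lt; apply: incr_below_nth it (ltnSn i) lt.
have D_lt i : i.+1 < size t -> D i < N.
  by move=> /T_incr[h1 h2]; apply: delta_lt => //; apply: ltn_trans h1 h2.
have D_neq i : i.+2 < size t -> D i != D i.+1.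
  by move=> lt; apply: delta_neq; [have [] := @T_incr i (ltnW lt)|have [] := T_incr _ lt].
(* If [b] is true, no local minimum can follow a descent; if [b] is false, no local maximum can
   follow an ascent. So once the direction disagrees with [b], it keeps disagreeing. *)
have [lo [v [lon run]]] : exists lo v, lo <= n /\
    forall i, lo <= i -> i.+1 < lo + n -> ((D i < D i.+1) == b) = v.
  apply: constant_run => i i2n.
  pose w := take k.+1 (drop i t).
  have sw : size w = k.+1 by apply: size_window; rewrite st; lia.
  have := mono w (window_subseq _ _ _) sw.
  have nw j : j < k -> nth 0 (deltas w) j = D (i + j).
    move=> jk; rewrite nth_deltas ?sw // !nth_window ?addnS //; lia.
  rewrite /step_color !nw; [|lia..]; rewrite addn0 addn1 addn2.
  have srt (r : rel nat) : sorted r (deltas w) -> r (D i) (D i.+1) /\ r (D i.+1) (D i.+2).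
    move=> /(sortedP 0); rewrite size_deltas sw => H.
    move: (H 0) (H 1); rewrite !nw; [|lia..].
    rewrite addn0 addn1 addn2 => h0 h1; split; [apply: h0|apply: h1]; lia.
  have n1 : D i != D i.+1 by apply: D_neq; lia.
  have n2 : D i.+1 != D i.+2 by apply: D_neq; lia.
  case: ifP => [/srt /= [h1 h2] _|_]; first by rewrite h1 h2.
  case: ifP => [/srt /= [h1 h2] _|_].
    by rewrite !ltnNge !(ltnW h1) !(ltnW h2).
  by case: {mono} b => H; lia.
have hi_t i : i < lo + n -> i.+1 < size t by lia.
have sub_run r : subseq r (iota lo n) -> size r = k -> exists a s,
    [/\ r = a :: s, path ltn a s, lo <= a & all (ltn^~ (lo + n)) (a :: s)].
  move=> rs sr.
  have srt : sorted ltn r by apply: subseq_sorted ltn_trans _ _ rs (iota_ltn_sorted _ _).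
  have mem x : x \in r -> lo <= x < lo + n by move/(mem_subseq rs); rewrite mem_iota.
  case: r sr srt mem {rs} => [|a s] sr srt mem; first by move: sr k3 => /= <-.
  exists a, s; split=> //; first by have /andP[] := mem a (mem_head _ _).
  by apply/allP => x /mem /andP[].
have inct i : i < lo + n -> T i < T i.+1 by move/hi_t/T_incr => [].
have mono_run (w s : seq nat) : sorted ltn s ->
    all (ltn^~ (size t)) s -> size s = k.+1 -> w = map T s -> step_color c w = b.
  by move=> s1 s2 s3 ->; apply: mono; [exact: map_nth_subseq|rewrite size_map].
have sorted_run (r : rel nat) :
    (forall i, lo <= i -> i.+1 < lo + n -> r (D i) (D i.+1)) ->
    sorted r (map D (iota lo n)).
  move=> H; apply/(sortedP 0) => i; rewrite size_map size_iota => ilt.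
  rewrite !(nth_map 0) ?size_iota ?(ltnW ilt) //.
  by rewrite !nth_iota ?(ltnW ilt) // addnS; apply: H; lia.
have dlt_all : all (ltn^~ N) (map D (iota lo n)).
  apply/allP => _ /mapP[i ii ->]; apply: D_lt; apply: hi_t.
  by move: ii; rewrite mem_iota => /andP[].
have [{run}inc|{run}dec] : (forall i, lo <= i -> i.+1 < lo + n -> D i < D i.+1) \/
    (forall i, lo <= i -> i.+1 < lo + n -> D i.+1 < D i).
  case vb: (v == b); [left|right] => i li il.
    by move: (run i li il) vb; case: (v); case: (b); case: (D i < D i.+1).
  have : D i != D i.+1 by apply: D_neq; lia.
  by move: (run i li il) vb; case: (v); case: (b); case: (ltngtP (D i)).
- apply: (rf (map D (iota lo n)) b).
  + by rewrite /incr_below dlt_all andbT; apply: sorted_run.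
  + by rewrite size_map size_iota.
  move=> u /subseq_map_ex[r rs ->]; rewrite size_map => sr.
  have [a [s [re pth la al]]] := sub_run r rs sr.
  have dl := deltas_incr_run inct inc la pth al.
  have srt : sorted ltn (map D r).
    apply: subseq_sorted ltn_trans _ _ _ (sorted_run _ inc).
    exact: map_subseq.
  rewrite -(mono_run (T a :: map (T \o succn) r) (a :: map succn r)).
  + by rewrite /step_color re dl -re srt.
  + by rewrite re /= ltnSn /= path_map; apply: sub_path pth => x y /=.
  + rewrite re; apply/allP => x; rewrite inE => /predU1P[->|].
      by have /andP[/hi_t/ltnW] := al.
    by case/mapP => y /(allP al)/hi_t ? ->.
  + by rewrite /= size_map sr.
  + by rewrite /= -map_comp.
have gtn_trans : transitive gtn by move=> x y z /= xy zx; apply: ltn_trans zx xy.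
have srtg : sorted gtn (map D (iota lo n)) by apply: sorted_run.
apply: (rf (rev (map D (iota lo n))) b).
- by rewrite /incr_below all_rev dlt_all andbT rev_sorted.
- by rewrite size_rev size_map size_iota.
move=> u; rewrite -[u]revK subseq_rev => /subseq_map_ex[r rs ->].
rewrite size_rev size_map => sr.
have [a [s [re pth la al]]] := sub_run r rs sr.
have dl := deltas_decr_run inct dec la pth al.
have srt : sorted gtn (map D r).
  by apply: subseq_sorted gtn_trans _ _ _ srtg; apply: map_subseq.
(* Since [3 <= k], the decreasing list is not increasing as well, so [step_color] reaches its
   reversing branch. *)
have nsrt : sorted ltn (map D r) = false.
  apply/negP => /(sortedP 0)/(_ 0); rewrite size_map sr.
  have := sortedP 0 srt 0; rewrite size_map sr /=; lia.
rewrite -(mono_run (rcons (map T r) (T (last a s).+1)) (rcons r (last a s).+1)).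
- by rewrite /step_color re dl -re srt nsrt.
- rewrite re /= rcons_path pth /=; exact: ltnSn.
- rewrite all_rcons re; apply/andP; split.
    by apply: hi_t; apply: (allP al); apply: mem_last.
  by apply/allP => y /(allP al)/hi_t/ltnW.
- by rewrite size_rcons sr.
- by rewrite map_rcons.
Qed.

Local Open Scope ring_scope.

(** * Sums over binary digits and their leading terms *)

Section BitSum.
Variable R : realFieldType.
Implicit Types (g : nat -> R) (M : R).

Definition bitsum g (N v : nat) : R := \sum_(i < N) (odd (v %/ 2 ^ i))%:R * g i.

(** Terms above [delta u v] cancel, the one at [delta u v] survives with coefficient 1, and lower
    coefficients differ by at most 1. *)
Lemma bitsum_sub g N (u v : nat) : (u < v)%N -> (delta u v < N)%N ->
  `|bitsum g N v - bitsum g N u - g (delta u v)| <= \sum_(i < delta u v) `|g i|.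
Proof.
move=> uv; elim: N => // N IH; rewrite ltnS leq_eqVlt => dN.
rewrite /bitsum !big_ord_recr /=; case/predU1P: dN => dN.
  have /andP[-> /negbTE ->] : odd (v %/ 2 ^ N) && ~~ odd (u %/ 2 ^ N) => [|/=].
    by rewrite -dN; apply: delta_bits.
  rewrite dN.
  have -> : forall a b : R, a + 1 * g N - (b + 0 * g N) - g N = a - b by move=> *; ring.
  rewrite -sumrB; apply: le_trans (ler_norm_sum _ _ _) _.
  apply: ler_sum => i _; rewrite -mulrBl normrM ler_piMl //.
  by case: (odd _); case: (odd _); rewrite ?subrr ?subr0 ?sub0r ?normrN ?normr0 ?normr1.
have E : odd (v %/ 2 ^ N) = odd (u %/ 2 ^ N).
  congr odd; apply/esym/eqP; have -> : N = N.-1.+1 by lia.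
  by rewrite -delta_leE; lia.
rewrite E.
by rewrite opprD addrACA subrr addr0; apply: IH.
Qed.

Lemma geometric_sum_le M (a : nat -> nat) (n : nat) : 1 < M ->
  (forall i, (i < n)%N -> (a i < a i.+1)%N) ->
  \sum_(i < n) M ^+ a i * (M - 1) <= M ^+ a n.
Proof.
move=> M1; elim: n => [|n IH] inc.
  by rewrite big_ord0 exprn_ge0 // ltW // (lt_trans ltr01).
rewrite big_ord_recr /=.
apply: le_trans (_ : M ^+ a n + M ^+ a n * (M - 1) <= _).
  by rewrite lerD2r; apply: IH => i ilt; apply: inc; apply: ltnW.
have -> : M ^+ a n + M ^+ a n * (M - 1) = M ^+ (a n).+1 by rewrite exprSr; ring.
by apply: ler_weXn2l; [exact: ltW|exact: inc].
Qed.

(** The numerator of [b / a - q] is at most [D * eta * (1 + B)], and [a] is at least [D / 2]. *)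
Lemma ratio_close (D eta B eps a b q : R) : 0 < D -> 0 <= eta -> eta <= 1 / 2 ->
  eta * (4 * (1 + B)) <= eps -> `|q| <= B ->
  `|a - D| <= D * eta -> `|b - D * q| <= D * eta ->
  0 < a /\ `|b / a - q| <= eps.
Proof.
move=> D0 eta0 eta1 He qB Ha Hb.
have De : D * eta <= D * (1 / 2) by rewrite ler_pM2l.
have aD : D / 2 <= a by move: Ha; rewrite ler_norml => /andP[? _]; lra.
have a0 : 0 < a by lra.
split=> //.
have -> : b / a - q = (b - D * q - q * (a - D)) / a by field; apply: lt0r_neq0.
rewrite normrM normfV [`|a|]gtr0_norm // ler_pdivrMr //.
have h1 : `|q * (a - D)| <= B * (D * eta) by rewrite normrM; apply: ler_pM.
have h2 := ler_normB (b - D * q) (q * (a - D)).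
have h3 : D * (eta * (4 * (1 + B))) <= D * eps by rewrite ler_pM2l.
have eps0 : 0 <= eps.
  apply: le_trans He; apply: mulr_ge0 => //.
  have := le_trans (normr_ge0 _) qB; lra.
have h4 : eps * (D / 2) <= eps * a by apply: ler_wpM2l.
have h5 : 0 <= eps * D by apply: mulr_ge0 => //; apply: ltW.
have : D * (eta * (4 * (1 + B))) = 4 * (D * eta) + 4 * (B * (D * eta)) by ring.
by move: h1 h2 h3 h4 h5 Hb; rewrite [D * eps]mulrC; lra.
Qed.

End BitSum.

(* A point of R^d is given by homogeneous coordinates [z i 0] (the weight, positive) and
   [z i j.+1]; up to a positive factor [diff z i] is the difference of the points [i.+1]
   and [i], whose first entry serves as weight for the remaining ones. No division is needed
   this way. *)
Definition diff (A : pzRingType) (z : nat -> nat -> A) (i j : nat) : A :=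
  z i.+1 j.+1 * z i 0 - z i j.+1 * z i.+1 0.

(* A predicate on [e.+4] points of R^(e+1). *)
Fixpoint tower_pred (R : realFieldType) (e : nat) (z : nat -> nat -> R) : bool :=
  let z1 := diff z in
  match e with
  | 0 =>
    let lt i := z1 i 0 * z i.+2 0 < z1 i.+1 0 * z i 0 in
    let gt i := z1 i.+1 0 * z i 0 < z1 i 0 * z i.+2 0 in
    if lt 0 && lt 1 || gt 0 && gt 1 then
      z1 1 0 ^+ 2 * (z 0 0 * z 3 0) < z1 0 0 * z1 2 0 * (z 1 0 * z 2 0)
    else lt 0 && gt 1
  | e'.+1 =>
    let z2 := diff z1 in
    if all (fun i => 0 < z2 i 0) (iota 0 e'.+3) then tower_pred e' z1
    else if all (fun i => z2 i 0 < 0) (iota 0 e'.+3)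
    then tower_pred e' (fun i => z1 (e'.+3 - i)%N)
    else (0 < z2 0 0) && (z2 1 0 < 0)
  end.

(** The sign of [diff z1 i 0] compares the first coordinates of the directions [i] and [i.+1]. The
    case distinction therefore mirrors that of [step_color]. *)
Lemma tower_predS (R : realFieldType) (e : nat) (z : nat -> nat -> R) :
  let z1 := diff z in
  tower_pred e.+1 z =
    if all (fun i => 0 < diff z1 i 0) (iota 0 e.+3) then tower_pred e z1
    else if all (fun i => diff z1 i 0 < 0) (iota 0 e.+3)
    then tower_pred e (fun i => z1 (e.+3 - i)%N)
    else (0 < diff z1 0 0) && (diff z1 1 0 < 0).
Proof. by []. Qed.

(** Index 0 is already one step above [color3], so that [tower_color e] colours [e.+4]-sets,
    matching the arity of [tower_pred e]. *)
Fixpoint tower_color (e : nat) : seq nat -> bool :=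
  step_color (if e is e'.+1 then tower_color e' else color3).

Fixpoint tower_size (e s : nat) : nat :=
  (2 ^ (if e is e'.+1 then tower_size e' s else 2 ^ s))%N.

(** * Colourings realized robustly by points, and the geometric step *)

Section Realization.
Variable R : realFieldType.
Implicit Types (z p : nat -> nat -> R) (eps : R).

Definition near_points (k d : nat) eps z p (u : seq nat) : Prop :=
  forall i, (i < k)%N -> 0 < z i 0 /\
    forall j, (j < d)%N -> `|z i j.+1 / z i 0 - p (nth 0%N u i) j| <= eps.

(** The gap condition lets the order of two indices be read off from first coordinates known up to
    [eps]; the next step needs this to compare deltas. *)
Definition realizes (e : nat) (c : seq nat -> bool) (N : nat) p eps : Prop :=
  [/\ 0 < eps,
      forall u v, (u < v)%N -> (v < N)%N -> 4 * eps <= p v 0 - p u 0 &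
      forall u z, incr_below N u -> size u = e.+4 ->
        near_points e.+4 e.+1 eps z p u -> tower_pred e z = c u].

Lemma diffE z i j : z i 0 != 0 -> z i.+1 0 != 0 ->
  diff z i j = (z i.+1 j.+1 / z i.+1 0 - z i j.+1 / z i 0) * (z i 0 * z i.+1 0).
Proof. by move=> h1 h2; rewrite /diff; field; rewrite h1 h2. Qed.

Lemma sorted_allE (r : rel nat) (s : seq nat) :
  sorted r s = all (fun i => r (nth 0%N s i) (nth 0%N s i.+1)) (iota 0 (size s).-1).
Proof.
apply/(sortedP 0%N)/allP => H i; last by move=> ilt; apply: H; rewrite mem_iota; lia.
by rewrite mem_iota => ilt; apply: H; lia.
Qed.

Lemma bounded_points p N d : exists2 B : R, 1 <= B &
  forall i j, (i < N)%N -> (j < d)%N -> `|p i j| <= B.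
Proof.
exists (1 + \sum_(i < N) \sum_(j < d) `|p i j|).
  by rewrite lerDl; apply: sumr_ge0 => i _; apply: sumr_ge0.
move=> i j iN jd.
rewrite (bigD1 (Ordinal iN)) //= (bigD1 (Ordinal jd)) //=.
set a := \sum_(_ < d | _) _; set b := \sum_(_ < N | _) _.
have a0 : 0 <= a by apply: sumr_ge0.
have b0 : 0 <= b by apply: sumr_ge0 => k _; apply: sumr_ge0.
lra.
Qed.

Lemma deltas_incr_below N v : (0 < N)%N -> incr_below (2 ^ N) v ->
  all (ltn^~ N) (deltas v).
Proof.
move=> N0 iv; apply/(all_nthP 0%N) => i; rewrite size_deltas => ilt.
rewrite nth_deltas; last by lia.
have [|h1 h2] := incr_below_nth iv (ltnSn i); first by lia.
by apply: delta_lt => //; apply: ltn_trans h1 h2.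
Qed.

Lemma deltas_neq N v i : incr_below N v -> (i.+2 < size v)%N ->
  nth 0%N (deltas v) i != nth 0%N (deltas v) i.+1.
Proof.
move=> iv lt; rewrite !nth_deltas //; last exact: ltnW.
have [h1 _] := incr_below_nth iv (ltnSn i) (ltnW lt).
by have [h2 _] := incr_below_nth iv (ltnSn i.+1) lt; apply: delta_neq.
Qed.

Lemma realizes_step e c N p eps : (0 < N)%N -> realizes e c N p eps ->
  exists p' eps', realizes e.+1 (step_color c) (2 ^ N) p' eps'.
Proof.
move=> N0 [eps0 gap real].
have [B B1 pB] := bounded_points p N e.+1.
pose eta := Num.min (1 / 2) (eps / (4 * (1 + B))).
have c0 : 0 < 4 * (1 + B) by lra.
have eta0 : 0 < eta by rewrite lt_min; apply/andP; split; [lra|apply: divr_gt0].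
have eta1 : eta <= 1 / 2 by rewrite ge_min lexx.
have eta2 : eta * (4 * (1 + B)) <= eps.
  by rewrite -ler_pdivlMr // ge_min lexx orbT.
(* Chosen so that [(M - 1) * (eta / 2) = B]: the lower bits then contribute at most [eta / 2] times
   the leading power of [M]. *)
pose M := 1 + 2 * B / eta.
have M1 : 1 < M by rewrite ltrDl divr_gt0 //; lra.
have M0 : 0 < M by lra.
pose q i j := if j is j'.+1 then p i j' else 1.
have qB i j : (i < N)%N -> (j < e.+2)%N -> `|q i j| <= B.
  by case: j => [|j] iN jd /=; [rewrite normr1|apply: pB].
pose p' v j := bitsum (fun i => M ^+ i * q i j) N v.
have p'_diff u v j : (u < v)%N -> (v < 2 ^ N)%N -> (j < e.+2)%N ->
    `|p' v j - p' u j - M ^+ delta u v * q (delta u v) j| <= M ^+ delta u v * (eta / 2).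
  move=> uv vN jd.
  have dN : (delta u v < N)%N by apply: delta_lt => //; apply: ltn_trans vN.
  apply: le_trans (bitsum_sub (fun i => M ^+ i * q i j) uv dN) _.
  apply: le_trans (_ : \sum_(i < delta u v) M ^+ i * (M - 1) * (eta / 2) <= _).
    apply: ler_sum => i _; rewrite normrM gtr0_norm ?exprn_gt0 // -mulrA.
    rewrite ler_pM2l ?exprn_gt0 //.
    have -> : (M - 1) * (eta / 2) = B.
      by rewrite /M; field; apply: lt0r_neq0.
    by apply: qB => //; apply: ltn_trans (ltn_ord i) dN.
  rewrite -mulr_suml ler_pM2r; last by lra.
  exact: (geometric_sum_le (a := id)).
(* Perturbing both ends costs [eta / 4] per difference; with the [eta / 2] from lower bits the
   relative error stays below [eta]. *)
exists p', (eta / 8); split; first by lra.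
  move=> u v uv vN; have := p'_diff u v 0%N uv vN isT.
  have : 1 <= M ^+ delta u v by apply: exprn_ege1; apply: ltW.
  have : M ^+ delta u v * (eta / 2) <= M ^+ delta u v * (1 / 4).
    by rewrite ler_pM2l ?exprn_gt0 //; lra.
  by rewrite /= ler_norml => h1 h2 /andP[h3 _]; lra.
move=> v z iv sv nz.
have sds : size (deltas v) = e.+4 by rewrite size_deltas sv.
pose ds := deltas v.
have dsE i : (i < e.+4)%N -> nth 0%N ds i = delta (nth 0%N v i) (nth 0%N v i.+1).
  by move=> ilt; rewrite nth_deltas // sv.
have dsN := deltas_incr_below N0 iv.
have ds_lt i : (i < e.+4)%N -> (nth 0%N ds i < N)%N.
  by move=> ilt; apply: (all_nthP 0%N dsN); rewrite sds.
(* The differences of the new points are, projectively, close to the old points indexed by the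
   deltas. *)
have nz1 : near_points e.+4 e.+1 eps (diff z) p ds.
  move=> i ilt.
  have [zi0 zi] := nz i (ltnW ilt); have [zi1 zii] := nz i.+1 ilt.
  have [|vi vN] := incr_below_nth iv (ltnSn i); first by rewrite sv.
  pose D := M ^+ nth 0%N ds i.
  have D1 : 1 <= D by apply: exprn_ege1; apply: ltW.
  have close j : (j < e.+2)%N ->
      `|z i.+1 j.+1 / z i.+1 0 - z i j.+1 / z i 0 - D * q (nth 0%N ds i) j| <= D * eta.
    move=> jd; have := p'_diff _ _ j vi vN jd; rewrite -dsE // -/D.
    have := zi j jd; have := zii j jd.
    have : eta <= D * eta by rewrite ler_peMl // ltW.
    by rewrite !ler_norml => h0 /andP[? ?] /andP[? ?] /andP[? ?]; lra.
  have close0 : `|z i.+1 1 / z i.+1 0 - z i 1 / z i 0 - D| <= D * eta.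
    by have := close 0%N isT; rewrite mulr1.
  have rc j (jd : (j < e.+1)%N) :=
    ratio_close (lt_le_trans ltr01 D1) (ltW eta0) eta1 eta2
      (pB _ j (ds_lt i ilt) jd) close0 (close j.+1 jd).
  have zz0 : 0 < z i 0 * z i.+1 0 by apply: mulr_gt0.
  split; first by rewrite diffE ?lt0r_neq0 // mulr_gt0 //; have [] := rc 0%N isT.
  move=> j jd; have [h1 h2] := rc j jd.
  rewrite !diffE ?lt0r_neq0 // -mulf_div divff ?lt0r_neq0 // mulr1.
  exact: h2.
(* Neighbouring deltas differ, so the gap condition of the old realization decides the sign of each
   second difference. *)
have z2E i : (i < e.+3)%N ->
    (0 < diff (diff z) i 0) = (nth 0%N ds i < nth 0%N ds i.+1)%N /\
    (diff (diff z) i 0 < 0) = (nth 0%N ds i.+1 < nth 0%N ds i)%N.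
  move=> ilt; have [zi0 zi] := nz1 i (ltnW ilt); have [zi1 zii] := nz1 i.+1 ilt.
  have h1 := zi 0%N isT; have h2 := zii 0%N isT.
  have zz0 : 0 < diff z i 0 * diff z i.+1 0 by apply: mulr_gt0.
  rewrite diffE ?lt0r_neq0 // pmulr_lgt0 // pmulr_llt0 // subr_gt0 subr_lt0.
  move: h1 h2; set a := _ / _; set b := _ / _; rewrite !ler_norml => /andP[? ?] /andP[? ?].
  have : nth 0%N ds i != nth 0%N ds i.+1 by apply: (deltas_neq iv); rewrite sv.
  case: ltngtP => // dd _; split; apply/idP.
  - by have := gap _ _ dd (ds_lt i.+1 ilt); lra.
  - by apply/negP; have := gap _ _ dd (ds_lt i.+1 ilt); lra.
  - by apply/negP; have := gap _ _ dd (ds_lt i (ltnW ilt)); lra.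
  - by have := gap _ _ dd (ds_lt i (ltnW ilt)); lra.
have srtE (r : rel nat) (f : nat -> bool) :
    (forall i, (i < e.+3)%N -> f i = r (nth 0%N ds i) (nth 0%N ds i.+1)) ->
    all f (iota 0 e.+3) = sorted r ds.
  move=> H; rewrite sorted_allE sds; apply: eq_in_all => i.
  by rewrite mem_iota => /andP[_ ilt]; apply: H.
rewrite tower_predS.
rewrite (srtE ltn) => [|i /z2E[]//]; rewrite (srtE gtn) => [|i /z2E[]//].
rewrite (z2E 0%N isT).1 (z2E 1%N isT).2 /step_color -/ds.
case: ifP => [srt|_]; first by apply: real => //; rewrite /incr_below srt.
case: ifP => [srt|//]; apply: real.
- by rewrite /incr_below rev_sorted srt all_rev.
- by rewrite size_rev.
move=> i ilt; have [|h1 h2] := nz1 (e.+3 - i)%N; first by rewrite ltnS leq_subr.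
split=> // j jd; rewrite nth_rev ?sds // subSS; exact: h2.
Qed.

End Realization.

(** * The base case in dimension 1 *)

(** The binary digits of [v] read in base 4: differences are then within a third of the power of 4
    at the delta, which is [base4_sub]. *)
Definition base4 (s v : nat) : nat := (\sum_(i < s) odd (v %/ 2 ^ i) * 4 ^ i)%N.

Lemma base4_bitsum (R : realFieldType) s v : (base4 s v)%:R = bitsum (fun i => 4 ^+ i : R) s v.
Proof. by rewrite natr_sum; apply: eq_bigr => i _; rewrite natrM natrX. Qed.

Lemma base4_sub (R : realFieldType) s u v : (0 < s)%N -> (u < v)%N -> (v < 2 ^ s)%N ->
  (2 * 4 ^+ delta u v <= 3 * ((base4 s v)%:R - (base4 s u)%:R) :> R) &&
  (3 * ((base4 s v)%:R - (base4 s u)%:R) <= 4 * 4 ^+ delta u v :> R).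
Proof.
move=> s0 uv vs; rewrite !base4_bitsum.
have ds : (delta u v < s)%N by apply: delta_lt => //; apply: ltn_trans vs.
have := bitsum_sub (fun i => 4 ^+ i : R) uv ds.
rewrite (eq_bigr (fun i : 'I__ => 4 ^+ i : R)); last first.
  by move=> i _; rewrite ger0_norm ?exprn_ge0.
have : \sum_(i < delta u v) 4 ^+ i * (4 - 1) <= 4 ^+ delta u v :> R.
  by apply: (geometric_sum_le (a := id)) => //; lra.
by rewrite -mulr_suml ler_norml => h1 /andP[h2 h3]; apply/andP; split; lra.
Qed.

Lemma base4_lt s u v : (0 < s)%N -> (u < v)%N -> (v < 2 ^ s)%N ->
  (base4 s u < base4 s v)%N.
Proof.
move=> s0 uv vs; have /andP[h _] := base4_sub rat s0 uv vs.
have : 0 < 4 ^+ delta u v :> rat by apply: exprn_gt0.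
by rewrite -(ltr_nat rat) => h1; lra.
Qed.

(** The leading powers of the two gaps differ by a factor of at least 4, more than the factor 2 of
    uncertainty between the bounds 2/3 and 4/3. *)
Lemma base4_convex s x y w : (0 < s)%N -> (x < y)%N -> (y < w)%N -> (w < 2 ^ s)%N ->
  if color3 [:: x; y; w] then (2 * base4 s y < base4 s x + base4 s w)%N
  else (base4 s x + base4 s w < 2 * base4 s y)%N.
Proof.
move=> s0 xy yw ws; rewrite /color3 /=.
have /andP[h1 h2] := base4_sub rat s0 xy (ltn_trans yw ws).
have /andP[h3 h4] := base4_sub rat s0 yw ws.
have p4 a b : (a < b)%N -> 4 * 4 ^+ a <= 4 ^+ b :> rat.
  by move=> ab; rewrite -exprS; apply: ler_weXn2l.
have p0 a : 0 < 4 ^+ a :> rat by apply: exprn_gt0.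
have := delta_neq xy yw.
case: ltngtP => // dd _; rewrite -(ltr_nat rat) natrD natrM;
  by have := p4 _ _ dd; have := p0 (delta x y); have := p0 (delta y w); lra.
Qed.

Lemma realizes_base (R : realFieldType) s : (0 < s)%N ->
  exists p eps, @realizes R 0 (step_color color3) (2 ^ (2 ^ s)) p eps.
Proof.
move=> s0; have [M ME] : exists M : R, M = 100 by exists 100.
pose m d := M ^+ base4 s d.
have M1 : 1 < M by rewrite ME; lra.
have M0 : 0 < M by lra.
have S0 : (0 < 2 ^ s)%N by rewrite expn_gt0.
have m1 d : 1 <= m d by apply: exprn_ege1; apply: ltW.
have m0 d : 0 < m d by apply: lt_le_trans (m1 d).
pose p (v j : nat) := bitsum m (2 ^ s) v.
have p_sub u v : (u < v)%N -> (v < 2 ^ (2 ^ s))%N ->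
    `|p v 0%N - p u 0%N - m (delta u v)| * 99 <= m (delta u v).
  move=> uv vN.
  have dN : (delta u v < 2 ^ s)%N by apply: delta_lt => //; apply: ltn_trans vN.
  apply: le_trans (_ : \sum_(i < delta u v) m i * (M - 1) <= _); last first.
    apply: geometric_sum_le => // i ilt; apply: base4_lt => //.
    exact: leq_ltn_trans dN.
  rewrite -mulr_suml (_ : M - 1 = 99); last by rewrite ME; ring.
  rewrite ler_pM2r; last by lra.
  apply: le_trans (bitsum_sub m uv dN) _.
  by apply: ler_sum => i _; rewrite gtr0_norm.
exists p, (1 / 100); split; first by lra.
  move=> u v uv vN; have := p_sub u v uv vN; rewrite -ler_pdivlMr; last by lra.
  by have := m1 (delta u v); rewrite ler_norml => h0 /andP[h1 h2]; lra.
move=> v z iv sv nz.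
have [[z0 n0] [z1 n1] [z2 n2] [z3 n3]] := And4 (nz 0%N isT) (nz 1%N isT) (nz 2 isT) (nz 3 isT).
pose D i := z i.+1 1 / z i.+1 0 - z i 1 / z i 0.
pose ds i := delta (nth 0%N v i) (nth 0%N v i.+1).
(* The relative error is at most 1/99 from lower bits and 2/100 from the perturbation, hence below
   1/10. *)
have Dm i : (i < 3)%N -> 9 * m (ds i) <= 10 * D i <= 11 * m (ds i).
  move=> ilt; have [|vi vN] := incr_below_nth iv (ltnSn i); first by rewrite sv.
  have := p_sub _ _ vi vN; rewrite -/(ds i) -ler_pdivlMr; last by lra.
  have [_ /(_ 0%N isT)] := nz i (ltnW ilt); have [_ /(_ 0%N isT)] := nz i.+1 ilt.
  rewrite !ler_norml => /andP[h1 h2] /andP[h3 h4] /andP[h5 h6].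
  by have := m1 (ds i); rewrite /D => h0; apply/andP; split; lra.
have ds_lt i : (i < 3)%N -> (ds i < 2 ^ s)%N.
  move=> ilt; have [|vi vN] := incr_below_nth iv (ltnSn i); first by rewrite sv.
  by apply: delta_lt => //; apply: ltn_trans vN.
have D_lt i j : (i < 3)%N -> (j < 3)%N -> (ds i < ds j)%N -> D i < D j.
  move=> i3 j3 dd; have /andP[_ h1] := Dm i i3; have /andP[h2 _] := Dm j j3.
  have : M * m (ds i) <= m (ds j).
    by rewrite -exprS; apply: ler_weXn2l; [exact: ltW|apply: base4_lt => //; apply: ds_lt].
  by have := m0 (ds i); rewrite ME; lra.
have ds_neq i : (i < 2)%N -> ds i != ds i.+1.
  move=> i2; have := @deltas_neq _ _ i iv; rewrite sv !nth_deltas ?sv //; last by lia.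
  by apply.
have D_ltE i : (i < 2)%N -> (D i < D i.+1) = (ds i < ds i.+1)%N.
  move=> i2; have := ds_neq i i2; have i3 := ltnW i2.
  case: ltngtP => // dd _; first exact: (D_lt i i.+1 i3 i2 dd).
  by apply/negbTE; rewrite -leNgt ltW //; apply: (D_lt i.+1 i i2 i3 dd).
have D_gtE i : (i < 2)%N -> (D i.+1 < D i) = (ds i.+1 < ds i)%N.
  move=> i2; have := ds_neq i i2; have i3 := ltnW i2.
  case: (ltngtP (ds i) (ds i.+1)) => // dd _; last exact: (D_lt i.+1 i i2 i3 dd).
  by apply/negbTE; rewrite -leNgt ltW //; apply: (D_lt i i.+1 i3 i2 dd).
have D0 i : (i < 3)%N -> 0 < D i by move=> i3; have /andP[h _] := Dm i i3; have := m0 (ds i); lra.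
(* This serves increasing deltas with [i = 0], [j = 2] and decreasing ones with the two swapped. The
   exponents of the two sides are distinct integers, so the main terms differ by a factor of at
   least [M = 100], beyond the error factor 121/81. *)
have convex i j : (i < 3)%N -> (j < 3)%N -> (ds i < ds 1%N)%N -> (ds 1%N < ds j)%N ->
    (D 1%N ^+ 2 < D i * D j) = color3 [:: ds i; ds 1%N; ds j].
  move=> i3 j3 d1 d2; have := base4_convex s0 d1 d2 (ds_lt _ j3).
  have /andP[a1 b1] := Dm i i3; have /andP[a2 b2] := Dm 1%N isT; have /andP[a3 b3] := Dm j j3.
  have l1 : 81 * (m (ds i) * m (ds j)) <= 100 * (D i * D j).
    have := ler_pM (mulr_ge0 (ler0n R 9) (ltW (m0 _))) (mulr_ge0 (ler0n R 9) (ltW (m0 _))) a1 a3.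
    lra.
  have l2 : 100 * (D i * D j) <= 121 * (m (ds i) * m (ds j)).
    have := ler_pM (mulr_ge0 (ler0n R 10) (ltW (D0 _ i3))) (mulr_ge0 (ler0n R 10) (ltW (D0 _ j3))) b1 b3.
    lra.
  have l3 : 81 * m (ds 1%N) ^+ 2 <= 100 * D 1%N ^+ 2.
    have := ler_pM (mulr_ge0 (ler0n R 9) (ltW (m0 _))) (mulr_ge0 (ler0n R 9) (ltW (m0 _))) a2 a2.
    rewrite !expr2; lra.
  have l4 : 100 * D 1%N ^+ 2 <= 121 * m (ds 1%N) ^+ 2.
    have := ler_pM (mulr_ge0 (ler0n R 10) (ltW (D0 1%N isT))) (mulr_ge0 (ler0n R 10) (ltW (D0 1%N isT))) b2 b2.
    rewrite !expr2; lra.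
  have p0 : 0 < m (ds i) * m (ds j) by apply: mulr_gt0.
  have p1 : 0 < m (ds 1%N) ^+ 2 by apply: exprn_gt0.
  case: (color3 _) => lt.
    have : M * m (ds 1%N) ^+ 2 <= m (ds i) * m (ds j).
      rewrite -exprM -exprD -exprS; apply: ler_weXn2l; first exact: ltW.
      by rewrite mulnC.
    by rewrite ME => h; lra.
  have : M * (m (ds i) * m (ds j)) <= m (ds 1%N) ^+ 2.
    rewrite -exprM -exprD -exprS; apply: ler_weXn2l; first exact: ltW.
    by rewrite [X in (_ < X)%N]mulnC.
  by rewrite ME => h; apply/negbTE; rewrite -leNgt; lra.
have dE i : (i < 3)%N -> diff z i 0 = D i * (z i 0 * z i.+1 0).
  move=> i3; rewrite diffE // lt0r_neq0 //; first by have [] := nz i (ltnW i3).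
  by have [] := nz i.+1 i3.
have dsE : deltas v = [:: ds 0%N; ds 1%N; ds 2].
  by case: v sv @ds {iv nz n0 n1 n2 n3 Dm ds_lt D_lt ds_neq D_ltE D_gtE convex} => [|? [|? [|? [|? []]]]].
(* These positive products of weights clear the denominators in the tests of [tower_pred]. *)
have c012 : 0 < z 0 0 * z 1 0 * z 2 0 by rewrite !mulr_gt0.
have c123 : 0 < z 1 0 * z 2 0 * z 3 0 by rewrite !mulr_gt0.
have c0123 : 0 < z 0 0 * z 1 0 ^+ 2 * z 2 0 ^+ 2 * z 3 0 by rewrite !mulr_gt0 ?exprn_gt0.
have lt0 : (diff z 0 0 * z 2 0 < diff z 1 0 * z 0 0) = (ds 0 < ds 1)%N.
  rewrite -D_ltE // !dE // -[RHS](ltr_pM2r c012); congr (_ < _); ring.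
have lt1 : (diff z 1 0 * z 3 0 < diff z 2 0 * z 1 0) = (ds 1 < ds 2)%N.
  rewrite -D_ltE // !dE // -[RHS](ltr_pM2r c123); congr (_ < _); ring.
have gt0 : (diff z 1 0 * z 0 0 < diff z 0 0 * z 2 0) = (ds 1 < ds 0)%N.
  rewrite -D_gtE // !dE // -[RHS](ltr_pM2r c012); congr (_ < _); ring.
have gt1 : (diff z 2 0 * z 1 0 < diff z 1 0 * z 3 0) = (ds 2 < ds 1)%N.
  rewrite -D_gtE // !dE // -[RHS](ltr_pM2r c123); congr (_ < _); ring.
have cvx : (diff z 1 0 ^+ 2 * (z 0 0 * z 3 0) < diff z 0 0 * diff z 2 0 * (z 1 0 * z 2 0))
    = (D 1%N ^+ 2 < D 0%N * D 2).
  rewrite !dE // -[RHS](ltr_pM2r c0123); congr (_ < _); ring.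
rewrite /tower_pred lt0 lt1 gt0 gt1 cvx /step_color dsE /= !andbT.
have := ds_neq 0%N isT; have := ds_neq 1%N isT.
case: ltngtP => d12 // _; case: ltngtP => d01 //= _.
- exact: convex.
- by rewrite mulrC; apply: convex.
Qed.

Lemma tower_color_realized (R : realFieldType) (e s : nat) : (0 < s)%N ->
  exists p eps, @realizes R e (tower_color e) (tower_size e s) p eps.
Proof.
move=> s0; elim: e => [|e [p [eps IH]]]; first exact: realizes_base.
by apply: realizes_step IH; case: (e) => *; rewrite expn_gt0.
Qed.

(** Each step replaces [n] by [2 * n + e.+4], so the forbidden size stays linear in [s] while
    [tower_size] gains an exponential. *)
Lemma tower_color_ramsey_free (e : nat) : exists A B, (0 < A)%N /\
  forall s, (0 < s)%N -> ramsey_free (tower_color e) e.+4 (tower_size e s) (A * s + B).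
Proof.
elim: e => [|e [A [B [A0 IH]]]].
  exists 2, 7; split=> // s s0.
  have -> : (2 * s + 7 = 2 * (s + 2) + 3)%N by lia.
  apply: step_color_ramsey_free; rewrite ?expn_gt0 //.
  exact: color3_ramsey_free.
exists (2 * A)%N, (2 * B + e.+4)%N; split=> [|s s0]; first by lia.
have -> : (2 * A * s + (2 * B + e.+4) = 2 * (A * s + B) + e.+4)%N by lia.
apply: step_color_ramsey_free (IH s s0) => //.
by case: (e) => *; rewrite expn_gt0.
Qed.

(** * Semialgebraic definability of the predicate *)

Fixpoint brename (t t' : nat) (f : 'I_t -> 'I_t') (phi : bformula t) : bformula t' :=
  match phi with
  | BVar l => BVar (f l)
  | BTrue => BTrue t'
  | BFalse => BFalse t'
  | BNot p => BNot (brename f p)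
  | BAnd p q => BAnd (brename f p) (brename f q)
  | BOr p q => BOr (brename f p) (brename f q)
  end.

Lemma beval_brename (t t' : nat) (f : 'I_t -> 'I_t') (A : 'I_t' -> bool) phi :
  beval A (brename f phi) = beval (A \o f) phi.
Proof. by elim: phi => //= [p -> //|p -> q ->|p -> q ->]. Qed.

Lemma eq_beval (t : nat) (A B : 'I_t -> bool) phi : A =1 B -> beval A phi = beval B phi.
Proof. by move=> AB; elim: phi => //= [p -> //|p -> q ->|p -> q ->]. Qed.

Section Definable.
Variables (R : realType) (k d : nat).
Implicit Types f g h : ('I_k -> 'rV[R]_d) -> bool.

Definition definable f : Prop :=
  exists Phi : semialg_pred R k d, forall x, holds Phi x = f x.

Lemma eq_definable f g : f =1 g -> definable f -> definable g.
Proof. by move=> fg [Phi H]; exists Phi => x; rewrite H fg. Qed.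

Lemma definable_true : definable (fun=> true).
Proof. by exists (SemialgPred (BTrue 0) (fun=> 0)). Qed.

(** Atoms are weak inequalities, so [0 < P] is the negation of [0 <= - P]. *)
Lemma definable_pos (P : mpoly.mpoly (k * d) R) :
  definable (fun x => 0 < mpoly.meval (coords x) P).
Proof.
exists (SemialgPred (BNot (BVar (ord0 : 'I_1))) (fun=> - P)) => x.
by rewrite /holds /= mpoly.mevalN oppr_ge0 -ltNge.
Qed.

Lemma definable_not f : definable f -> definable (fun x => ~~ f x).
Proof.
move=> [Phi H]; exists (SemialgPred (BNot (sa_formula Phi)) (sa_poly Phi)) => x.
by rewrite -H.
Qed.

Lemma definable_and f g : definable f -> definable g -> definable (fun x => f x && g x).
Proof.
move=> [[t1 p1 P1] H1] [[t2 p2 P2] H2].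
(* The atoms of both predicates are listed one after the other. *)
pose P (l : 'I_(t1 + t2)) := match split l with inl a => P1 a | inr b => P2 b end.
exists (SemialgPred (BAnd (brename (@lshift t1 t2) p1) (brename (@rshift t1 t2) p2)) P).
move=> x; rewrite -H1 -H2 /holds /= !beval_brename; congr (_ && _); apply: eq_beval => l /=.
  by rewrite /P (unsplitK (inl l)).
by rewrite /P (unsplitK (inr l)).
Qed.

Lemma definable_if f g h : definable f -> definable g -> definable h ->
  definable (fun x => if f x then g x else h x).
Proof.
move=> df dg dh.
have := definable_and (definable_not (definable_and df (definable_not dg)))
          (definable_not (definable_and (definable_not df) (definable_not dh))).
by apply: eq_definable => x; case: (f x); case: (g x); case: (h x).
Qed.

Lemma definable_all (s : seq nat) (F : nat -> ('I_k -> 'rV[R]_d) -> bool) :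
  (forall i, definable (F i)) -> definable (fun x => all (F^~ x) s).
Proof.
move=> dF; elim: s => [|i s IH]; first exact: definable_true.
exact: definable_and.
Qed.

Lemma definable_lt (P Q : mpoly.mpoly (k * d) R) :
  definable (fun x => mpoly.meval (coords x) P < mpoly.meval (coords x) Q).
Proof.
apply: eq_definable (definable_pos (Q - P)) => x.
by rewrite mpoly.mevalB subr_gt0.
Qed.

Definition eval_array (Z : nat -> nat -> mpoly.mpoly (k * d) R) x i j : R :=
  mpoly.meval (coords x) (Z i j).

Lemma diff_eval_array Z x : diff (eval_array Z x) = eval_array (diff Z) x.
Proof.
by apply/funext => i; apply/funext => j; rewrite /eval_array mpoly.mevalB !mpoly.mevalM.
Qed.

(** Evaluation commutes with [diff]. The induction is over all arrays [Z] of polynomials, because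
    the recursion passes to [diff Z] and its reversal. *)
Lemma definable_tower_pred (e : nat) Z :
  definable (fun x => tower_pred e (eval_array Z x)).
Proof.
elim: e Z => [|e IH] Z.
  have lt2 i j a b i' j' a' b' : definable (fun x =>
      diff (eval_array Z x) i j * eval_array Z x a b <
      diff (eval_array Z x) i' j' * eval_array Z x a' b').
    apply: eq_definable (definable_lt (diff Z i j * Z a b) (diff Z i' j' * Z a' b')) => x.
    by rewrite !mpoly.mevalM diff_eval_array.
  have or f g : definable f -> definable g -> definable (fun x => f x || g x).
    by move=> df dg; apply: definable_if definable_true dg.
  apply: definable_if; last exact: definable_and.
    by apply: or; apply: definable_and.
  apply: eq_definable (definable_lt (diff Z 1 0 ^+ 2 * (Z 0 0 * Z 3 0))
     (diff Z 0 0 * diff Z 2 0 * (Z 1 0 * Z 2 0))) => x.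
  by rewrite expr2 !mpoly.mevalM diff_eval_array.
have pos i : definable (fun x => 0 < diff (diff (eval_array Z x)) i 0).
  by apply: eq_definable (definable_pos (diff (diff Z) i 0)) => x; rewrite !diff_eval_array.
have neg i : definable (fun x => diff (diff (eval_array Z x)) i 0 < 0).
  apply: eq_definable (definable_pos (- diff (diff Z) i 0)) => x.
  by rewrite !diff_eval_array mpoly.mevalN oppr_gt0.
apply: (eq_definable (fun x => esym (tower_predS e (eval_array Z x)))).
apply: definable_if; first exact: definable_all.
  by apply: eq_definable (IH (diff Z)) => x; rewrite diff_eval_array.
apply: definable_if; [exact: definable_all| |exact: definable_and].
apply: eq_definable (IH (fun i => diff Z (e.+3 - i)%N)) => x.
by rewrite diff_eval_array.
Qed.

(** Homogeneous coordinates of the given points, with constant weight 1; entries out of range are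
    set to 0. *)
Definition coord_poly (i j : nat) : mpoly.mpoly (k * d) R :=
  if j is j'.+1 then
    match insub i : option 'I_k, insub j' : option 'I_d with
    | Some a, Some b => mpoly.mpolyX R (mpoly.mnm1 (mxvec_index a b))
    | _, _ => 0
    end
  else 1.

Lemma eval_coord_poly0 x i : eval_array coord_poly x i 0 = 1.
Proof. exact: mpoly.meval1. Qed.

Lemma eval_coord_poly x (i : 'I_k) (j : 'I_d) :
  eval_array coord_poly x i j.+1 = x i 0 j.
Proof.
by rewrite /eval_array /= !valK mpoly.mevalXU /coords mxvecE mxE.
Qed.

End Definable.

(** * From colourings to the lower bound for the Ramsey number *)

Lemma tower_size_lt_ramsey (R : realType) (e n s : nat) (Phi : semialg_pred R (e.+1 + 3) e.+1) :
  (forall x, holds Phi x = tower_pred e (eval_array (@coord_poly R _ _) x)) ->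
  (0 < s)%N -> ramsey_free (tower_color e) e.+4 (tower_size e s) n ->
  (tower_size e s < ramsey_number Phi n)%N.
Proof.
move=> HPhi s0 rf; rewrite /ramsey_number; case: ex_minnP => N' /asboolP RP _.
rewrite ltnNge; apply/negP => N'N.
have [p [eps [eps0 _ real]]] := tower_color_realized R e s0.
pose pt i : 'rV[R]_e.+1 := \row_j p i j.
have sP : size (map pt (iota 0 N')) == N' by rewrite size_map size_iota.
have [q [/subseq_map_ex[r rs qr] hom]] := RP (Tuple sP).
have sr : size r = n by rewrite -(size_tuple q) qr size_map.
have ir : incr_below (tower_size e s) r.
  apply: incr_below_subseq rs _; rewrite /incr_below iota_ltn_sorted.
  by apply/allP => x; rewrite mem_iota => /andP[_ xN]; apply: leq_trans N'N.
have {}hom : exists b, forall i : 'I_(e.+1 + 3) -> 'I_n, {homo i : a b / (a < b)%N} ->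
    holds Phi (fun a => tnth q (i a)) = b.
  by case: hom => hom; [exists true|exists false] => i /hom // /negbTE.
have [b {}hom] := hom.
apply: (rf r b ir sr) => u ur su.
have iu := incr_below_subseq ur ir.
(* Homogeneity speaks of positions in [q], so [u] is written through its positions [idx] in [r]. *)
have [idx idxs ue] : exists2 idx, subseq idx (iota 0 n) & u = map (nth 0%N r) idx.
  by apply: subseq_map_ex; rewrite -sr -/(mkseq _ _) mkseq_nth.
have sidx : size idx = (e.+1 + 3)%N by rewrite -(size_map (nth 0%N r)) -ue su addn3.
have idxn (a : 'I_(e.+1 + 3)) : (nth 0%N idx a < n)%N.
  have : nth 0%N idx a \in iota 0 n by apply: (mem_subseq idxs); rewrite mem_nth ?sidx.
  by rewrite mem_iota.
rewrite -(hom (fun a => Ordinal (idxn a))); last first.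
  move=> a a' aa' /=.
  have srt : sorted ltn idx by apply: subseq_sorted ltn_trans _ _ idxs (iota_ltn_sorted _ _).
  by have := sorted_ltn_nth ltn_trans 0%N srt; apply=> //; rewrite inE sidx.
rewrite HPhi; apply/esym/real => // i ie.
(* The realizing points themselves are used, with weight 1, so the deviation is 0. *)
rewrite eval_coord_poly0; split=> // j je; rewrite divr1.
have ie' : (i < e.+1 + 3)%N by rewrite addn3.
rewrite (eval_coord_poly _ (Ordinal ie') (Ordinal je)).
rewrite (tnth_nth 0) /= qr (nth_map 0%N) ?sr ?(idxn (Ordinal ie')) // /pt mxE /=.
by rewrite ue (nth_map 0%N) ?sidx // subrr normr0 ltW.
Qed.

Lemma iter_powR2_le (R : realType) (m : nat) (x y : R) : x <= y ->
  iter m (fun t : R => 2 `^ t) x <= iter m (fun t : R => 2 `^ t) y.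
Proof. by move=> xy; elim: m => //= m IH; apply: ler_powR => //; lra. Qed.

Lemma tower_sizeE (R : realType) (e s : nat) :
  (tower_size e s)%:R = iter e.+2 (fun t : R => 2 `^ t) s%:R.
Proof.
elim: e => [|e IH] /=; rewrite natrX -powR_mulrn //.
  by rewrite natrX -powR_mulrn.
by rewrite IH.
Qed.

Theorem theorem1p3 (R : realType) (d : nat) (hd : (2 <= d)%N) :
  exists (Phi : semialg_pred R (d + 3) d) (c : R),
    0 < c /\
    exists n0 : nat, forall n : nat, (n0 <= n)%N ->
      twr (d + 3 - 1) (c * n%:R) <= (ramsey_number Phi n)%:R.
Proof.
case: d hd => // e _.
have [Phi HPhi] := definable_tower_pred e (@coord_poly R (e.+1 + 3) e.+1).
have [A [B [A0 rf]]] := tower_color_ramsey_free e.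
have A0' : 0 < (2 * A%:R)^-1 :> R by rewrite invr_gt0 mulr_gt0 // ltr0n.
exists Phi, (2 * A%:R)^-1; split=> //.
(* From [n < A * s + A + B] and [A + B <= n / 2] it follows that [n <= 2 * A * s], that is,
   [c * n <= s]. *)
exists (2 * (A + B))%N => n nn.
pose s := ((n - B) %/ A)%N.
have s0 : (0 < s)%N by rewrite divn_gt0 //; lia.
have sn1 : (A * s + B <= n)%N by have := leq_trunc_div (n - B) A; rewrite -/s; lia.
have sn2 : (n <= 2 * A * s)%N by have := ltn_ceil (n - B) A0; rewrite -/s; lia.
have lt := tower_size_lt_ramsey HPhi s0 (ramsey_free_leq sn1 (rf s s0)).
apply: le_trans (_ : (tower_size e s)%:R <= _); last by rewrite ler_nat ltnW.
rewrite tower_sizeE /twr.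
(* [twr] of index [e.+3] applies [e.+2] exponentials, as many as [tower_size e]. *)
have -> : (e.+1 + 3 - 1).-1 = e.+2 by lia.
apply: iter_powR2_le; rewrite mulrC ler_pdivrMr; last by rewrite mulr_gt0 // ltr0n.
by rewrite -natrM -natrM ler_nat mulnC.
Qed.
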